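(* Suppose that for each $i\in\mathcal N=\{1,\dots,n\}$ the control function $f_i$ is non-increasing on $\mathbb R$, strictly decreasing and differentiable on $(-\infty,-\delta_i/2)\cup(\delta_i/2,+\infty)$, and that there is $\overline\alpha_i>0$ with $|f_i'(v_i)|\le\overline\alpha_i$ for all $v_i\in(-\infty,-\delta_i/2)\cup(-\delta_i/2,\delta_i/2)\cup(\delta_i/2,+\infty)$. Let $\overline A=\mathrm{diag}\{\overline\alpha_1,\dots,\overline\alpha_n\}$. If $$\sigma_{\max}(\overline A X)<1,$$ where $\sigma_{\max}$ denotes the largest singular value, then the dynamical system $\mathcal D_1$ $$v(t)=Xq(t)+\tilde v,\qquad q_i(t+1)=\big[f_i\big(v_i(t)-v_i^{\mathrm{nom}}\big)\big]_{\Omega_i},\quad i\in\mathcal N,$$ converges (from any initial $q(0)\in\Omega$) to its unique equilibrium point $(v^*,q^* )$. Moreover, it converges exponentially fast to the equilibrium.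
   Context: Network: a tree with vertex set $\{0,1,\dots,n\}$ and edge set $\mathcal L$; each line $(h,k)\in\mathcal L$ has reactance $x_{hk}>0$. $\mathcal L_i\subseteq\mathcal L$ is the set of lines on the unique path from bus $0$ to bus $i$, and $X\in\mathbb R^{n\times n}$ is given by $X_{ij}=\sum_{(h,k)\in\mathcal L_i\cap\mathcal L_j}x_{hk}$ (a symmetric positive definite matrix). $\tilde v\in\mathbb R^n$ is a constant vector and $v^{\mathrm{nom}}=(1,\dots,1)^\top$. Feasible sets: $\Omega=\prod_{i=1}^n\Omega_i$, $\Omega_i=\{q_i: q_i^{\min}\le q_i\le q_i^{\max}\}$. For a bus with a controllable inverter, $q_i^{\max}=\min\{p_i\tan\rho_i,\sqrt{s_i^2-p_i^2}\}$ and $q_i^{\min}=-q_i^{\max}$, with constants $0\le p_i\le s_i$, $0\le\rho_i\le\pi/2$ (if $\rho_i=\pi/2$ the $\tan$ term is omitted); for a bus without one, $\Omega_i$ is a singleton. $[\cdot]_{\Omega_i}$ is the projection onto $\Omega_i$, and $[\cdot]_\Omega$ acts componentwise. Control functions: $f_i:\mathbb R\to\mathbb R$ is continuous, with a deadband of width $\delta_i\ge 0$ on which the control is zero: $f_i(v)=0$ for $v\in[-\delta_i/2,\delta_i/2]$. $f(v)=(f_1(v_1),\dots,f_n(v_n))$. Equilibrium: $(v^*,q^* )$ is an equilibrium point of $\mathcal D_1$ if $v^*=Xq^*+\tilde v$ and $q^*=[f(v^*-v^{\mathrm{nom}})]_\Omega$. *)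

(* Defs.v *)
From HB Require Import structures.
From mathcomp Require Import all_boot all_order all_algebra.
From mathcomp Require Import all_classical all_reals all_analysis.

Set Implicit Arguments.
Unset Strict Implicit.
Unset Printing Implicit Defensive.

Import Order.TTheory GRing.Theory Num.Theory.
Import numFieldNormedType.Exports.

Local Open Scope ring_scope.
Local Open Scope classical_set_scope.

(* Buses are 'I_n.+1, the root bus being ord0. Lines are undirected, so a line
   is the two-element set of its endpoints, and reactances are indexed by lines
   rather than by ordered pairs of buses. *)

Section Graph.
Variable V : finType.
Implicit Type L : {set {set V}}.

Definition adj L : rel V := fun h k => [set h; k]%SET \in L.

(* [size c <= 2] discards the degenerate closed walks h, k, h along one line. *)
Definition is_tree L : Prop :=
  [/\ forall l, l \in L -> #|l| = 2%N,
      forall h k, connect (adj L) h k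
    & forall c : seq V, ucycle (adj L) c -> (size c <= 2)%N].

(* The start h is not listed in p, as in [path]. *)
Definition simple_path L (h k : V) : set (seq V) :=
  [set p | [/\ path (adj L) h p, last h p = k & uniq (h :: p)]].

Definition path_lines (h : V) (p : seq V) : {set {set V}} :=
  [set:: [seq [set e.1; e.2]%SET | e <- zip (h :: p) p]]%SET.

(* In a tree there is exactly one simple path, so the choice made by [xget] is
   immaterial and its default value is never used. *)
Definition lines_between L (h k : V) : {set {set V}} :=
  path_lines h (xget [::] (simple_path L h k)).

End Graph.

(* The index i : 'I_n stands for the non-root bus [lift ord0 i] (number i+1). *)
Definition root_lines n (L : {set {set 'I_n.+1}}) (i : 'I_n) :
    {set {set 'I_n.+1}} :=
  lines_between L ord0 (lift ord0 i).

Definition reactance_mx (R : realType) n (L : {set {set 'I_n.+1}})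
    (x : {set 'I_n.+1} -> R) : 'M[R]_n :=
  \matrix_(i, j) \sum_(l in root_lines L i :&: root_lines L j) x l.

Section Control.
Variable R : realType.
Implicit Types (p s rho qc d : R).

Definition q_max p s rho : R :=
  if rho == pi / 2 then Num.sqrt (s ^+ 2 - p ^+ 2)
  else Num.min (p * tan rho) (Num.sqrt (s ^+ 2 - p ^+ 2)).

(* [inverter] tells whether the bus has a controllable inverter; otherwise its
   reactive power injection is the constant qc. *)
Definition feasible (inverter : bool) p s rho qc : set R :=
  if inverter then `[- q_max p s rho, q_max p s rho] else [set qc].

Definition metric_proj (A : set R) (y : R) : R :=
  xget y [set z | A z /\ forall w, A w -> `|y - z| <= `|y - w|].

Definition deadband d : set R := `[- (d / 2), d / 2].

Definition off_deadband d : set R := `]-oo, - (d / 2)[ `|` `]d / 2, +oo[.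

Definition singular_values m n (M : 'M[R]_(m, n)) : set R :=
  [set Num.sqrt a | a in [set a | eigenvalue (M^T *m M) a]].

(* The set is finite, so the supremum is a maximum unless n = 0. *)
Definition sigma_max m n (M : 'M[R]_(m, n)) : R := sup (singular_values M).

Variable n : nat.
Implicit Types (Om : 'I_n -> set R) (f : 'I_n -> R -> R) (X : 'M[R]_n).
Implicit Types (vt v q : 'cV[R]_n).

Definition Omega Om : set 'cV[R]_n := [set q | forall i, Om i (q i 0)].

Definition v_nom : 'cV[R]_n := const_mx 1.

(* v |-> [f (v - v_nom)]_Omega, the projection acting componentwise. *)
Definition control Om f v : 'cV[R]_n :=
  \col_i metric_proj (Om i) (f i ((v - v_nom) i 0)).

Definition trajectory X vt Om f (v q : nat -> 'cV[R]_n) : Prop :=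
  [/\ Omega Om (q 0%N),
      forall t, v t = X *m q t + vt
    & forall t, q t.+1 = control Om f (v t)].

Definition equilibrium X vt Om f v q : Prop :=
  v = X *m q + vt /\ q = control Om f v.

End Control.

(* Main.v *)
(* The map q |-> [f (X q + vt - v_nom)]_Omega is a contraction for the Euclidean
   norm: the projection is nonexpansive, f_i is alpha_i-Lipschitz by the mean
   value theorem on each side of the deadband, and the spectral norm of the
   matrix A X is its largest singular value. Equivalence of norms transfers the
   resulting geometric rate to the max norm.

   For the spectral norm, let mu be the least constant with |M u|^2 <= mu |u|^2.
   The form mu |u|^2 - |M u|^2 is positive semidefinite; if mu were not an
   eigenvalue of M^T M, this form would also be nondegenerate, hence coercive,
   and mu could be decreased. *)
Require Import Defs.
From HB Require Import structures.
From mathcomp Require Import all_boot all_order all_algebra.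
From mathcomp Require Import all_classical all_reals all_analysis.
From mathcomp Require Import ring lra.
Import Order.TTheory GRing.Theory Num.Theory.
Import numFieldNormedType.Exports.
Local Open Scope ring_scope.
Local Open Scope classical_set_scope.

(** * Squared Euclidean norm and the spectral norm *)

Section SquaredEuclideanNorm.
Context {R : realType}.

Definition sqn {n} (u : 'cV[R]_n) : R := \sum_i u i 0 ^+ 2.

Definition dotp {n} (u w : 'cV[R]_n) : R := \sum_i u i 0 * w i 0.

Lemma sqnE {n} (u : 'cV[R]_n) : sqn u = dotp u u.
Proof. by apply: eq_bigr => i _; rewrite expr2. Qed.

Lemma sqn_ge0 {n} (u : 'cV[R]_n) : 0 <= sqn u.
Proof. by apply: sumr_ge0 => i _; exact: sqr_ge0. Qed.

Lemma sqn_eq0 {n} (u : 'cV[R]_n) : sqn u = 0 -> u = 0.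
Proof.
move/psumr_eq0P => u0; apply/colP => i; rewrite mxE.
by apply/eqP; rewrite -sqrf_eq0 u0// => j _; exact: sqr_ge0.
Qed.

Lemma sqn_diag_mx_le {n} (a : 'I_n -> R) (u w : 'cV[R]_n) :
  (forall i, `|u i 0| <= a i * `|w i 0|) ->
  sqn u <= sqn (diag_mx (\row_i a i) *m w).
Proof.
move=> uw; apply: ler_sum => i _; rewrite mul_diag_mx !mxE -[leLHS]real_normK ?num_real//.
  rewrite exprMn -[w i 0 ^+ 2]real_normK ?num_real// -exprMn.
  by rewrite lerXn2r ?nnegrE//; apply: le_trans (uw i).
Qed.

Lemma sqnD_scale {n} (u w : 'cV[R]_n) t :
  sqn (u + t *: w) = sqn u + t *+ 2 * dotp u w + t ^+ 2 * sqn w.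
Proof.
rewrite /sqn /dotp !mulr_sumr -!big_split; apply: eq_bigr => i _ /=.
by rewrite !mxE; ring.
Qed.

Lemma dotpBZl {n} (u v w : 'cV[R]_n) a :
  dotp (a *: u - v) w = a * dotp u w - dotp v w.
Proof.
rewrite /dotp mulr_sumr -sumrB; apply: eq_bigr => i _ /=.
by rewrite !mxE; ring.
Qed.

Lemma dotp_mulmx {m n} (M : 'M[R]_(m, n)) (u w : 'cV[R]_n) :
  dotp (M *m u) (M *m w) = dotp (M^T *m M *m u) w.
Proof.
have dotpE k (a b : 'cV[R]_k) : dotp a b = (a^T *m b) 0 0.
  by rewrite mxE; apply: eq_bigr => i _; rewrite mxE.
by rewrite !dotpE !trmx_mul trmxK !mulmxA.
Qed.

(** The norm of matrices is the max norm: if nonzero it is attained at an entry, whose square is one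
    term of the sum. *)
Lemma ler_norm_sqn {n} (u : 'cV[R]_n) : `|u| ^+ 2 <= sqn u.
Proof.
rewrite /Num.Def.normr/=; have [->|/mx_norm_neq0[[i j] ->]] := eqVneq (mx_norm u) 0.
  by rewrite expr0n sqn_ge0.
rewrite /= ord1 real_normK ?num_real// /sqn (bigD1 i)//= lerDl.
by apply: sumr_ge0 => k _; exact: sqr_ge0.
Qed.

Lemma ler_sqn_norm {n} (u : 'cV[R]_n) : sqn u <= n%:R * `|u| ^+ 2.
Proof.
apply: (@le_trans _ _ (\sum_(i < n) `|u| ^+ 2)); last first.
  by rewrite sumr_const card_ord mulr_natl.
apply: ler_sum => i _; rewrite -real_normK ?num_real// lerXn2r ?nnegrE//.
rewrite [leRHS]/Num.Def.normr/= mx_normrE.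
exact: (le_bigmax _ (fun ij : 'I_n * 'I_1 => `|u ij.1 ij.2|) (i, 0)).
Qed.

(** A crude bound by the sum of squared entries; only its finiteness matters. The added 1 keeps [K]
    positive. *)
Lemma sqn_mulmx_bounded {m n} (M : 'M[R]_(m, n)) :
  exists2 K, 0 < K & forall u, sqn (M *m u) <= K * sqn u.
Proof.
exists (1 + n%:R * \sum_i \sum_j M i j ^+ 2).
  by rewrite ltr_pwDl// mulr_ge0// ?ler0n// sumr_ge0// => i _;
    rewrite sumr_ge0// => j _; exact: sqr_ge0.
move=> u; rewrite mulrDl mul1r.
(* Cauchy-Schwarz against the all-ones vector, from [2ab <= a^2 + b^2]. *)
have sq_sum (a : 'I_n -> R) : (\sum_j a j) ^+ 2 <= n%:R * \sum_j a j ^+ 2.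
  rewrite expr2 mulr_suml (@le_trans _ _ (\sum_i \sum_j (a i ^+ 2 / 2 + a j ^+ 2 / 2)))//.
    apply: ler_sum => i _; rewrite mulr_sumr; apply: ler_sum => j _.
    by have := sqr_ge0 (a i - a j); lra.
  under eq_bigr do rewrite big_split sumr_const card_ord/=.
  rewrite big_split sumr_const card_ord/= sumrMnl -!mulr_suml -mulrnDl.
  by rewrite -splitr mulr_natl.
apply: (@le_trans _ _ (\sum_i n%:R * \sum_j (M i j ^+ 2 * sqn u))).
  apply: ler_sum => i _; rewrite mxE; apply: le_trans (sq_sum _) _.
  rewrite ler_wpM2l ?ler0n//; apply: ler_sum => j _; rewrite exprMn.
  rewrite ler_wpM2l ?sqr_ge0// /sqn (bigD1 j)//= lerDl.
  by apply: sumr_ge0 => k _; exact: sqr_ge0.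
rewrite -mulr_sumr -mulrA mulr_suml; under eq_bigr do rewrite -mulr_suml.
by rewrite lerDr sqn_ge0.
Qed.

(* Evaluate the nonnegative form at u + t w with w = mu u - M^T M u and
   t = - 1 / (mu + 1). *)
Lemma sqn_gradient_le {m n} (M : 'M[R]_(m, n)) mu (u : 'cV[R]_n) :
  (forall w, sqn (M *m w) <= mu * sqn w) -> 0 <= mu ->
  sqn (mu *: u - M^T *m M *m u) <= (mu + 1) * (mu * sqn u - sqn (M *m u)).
Proof.
move=> Mmu mu0; set w := mu *: u - _; set t := - (mu + 1)^-1.
have := Mmu (u + t *: w).
rewrite mulmxDr -scalemxAr !sqnD_scale dotp_mulmx.
have wE : mu * dotp u w - dotp (M^T *m M *m u) w = sqn w.
  by rewrite sqnE -dotpBZl.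
have t0 : (mu + 1) * t = -1 by rewrite mulrN divff// gt_eqF// ltr_wpDl.
have := sqn_ge0 (M *m w); have := sqn_ge0 w.
move: (dotp (M^T *m M *m u) w) (dotp u w) (sqn w) (sqn (M *m w)) wE => d e W N wE W0 N0.
move: (sqn u) (sqn (M *m u)) => U V H.
have t_le0 : t <= 0 by rewrite oppr_le0 invr_ge0 addr_ge0.
have s_ge0 : 0 <= mu + 1 by rewrite addr_ge0.
have : 0 <= (mu + 1) * (mu * U - V + t *+ 2 * W + t ^+ 2 * (mu * W)).
  by rewrite mulr_ge0//; nra.
have -> : (mu + 1) * (mu * U - V + t *+ 2 * W + t ^+ 2 * (mu * W)) =
  (mu + 1) * (mu * U - V) + ((mu + 1) * t) * (2 + t * mu) * W by ring.
(* The coefficient of [W] becomes [- (1 - t)], at most -1 because [t <= 0]. *)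
rewrite t0; have : t * mu = -1 - t by rewrite -t0; ring.
by move=> ->; nra.
Qed.

Lemma sqn_mulmx_le_sigma_max {m n} (M : 'M[R]_(m, n)) (u : 'cV[R]_n) :
  sqn (M *m u) <= sigma_max M ^+ 2 * sqn u.
Proof.
case: n => [|n] in M u *.
  by rewrite [u]flatmx0 mulmx0 /sqn big_ord0 mulr0 big1// => i _; rewrite mxE expr0n.
pose S := [set K | forall w, sqn (M *m w) <= K * sqn w].
have S_ge0 K : S K -> 0 <= K.
  move=> /(_ (const_mx 1)) SK; rewrite -(@pmulr_lge0 _ (sqn (const_mx 1 : 'cV_n.+1))).
    exact: le_trans (sqn_ge0 _) SK.
  rewrite lt_def sqn_ge0 andbT; apply/eqP => /sqn_eq0/colP/(_ 0).
  by rewrite !mxE; apply/eqP; rewrite oner_eq0.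
have S0 : S !=set0 by have [K _ ?] := sqn_mulmx_bounded M; exists K.
have lbS : has_lbound S by exists 0 => K /S_ge0.
pose mu := inf S.
(* The infimum lies in [S]: for [w] nonzero, the quotient of [sqn (M *m w)] by [sqn w] is a lower
   bound of [S]. *)
have Smu : S mu.
  move=> w; have [/sqn_eq0->|w0] := eqVneq (sqn w) 0.
    by rewrite mulmx0 /sqn !big1 ?mulr0// => i _; rewrite mxE expr0n.
  have {}w0 : 0 < sqn w by rewrite lt_def w0 sqn_ge0.
  rewrite -ler_pdivrMr//; apply: lb_le_inf => // K SK.
  by rewrite ler_pdivrMr.
have mu0 : 0 <= mu := S_ge0 _ Smu.
have eig_mu : eigenvalue (M^T *m M) mu.
  rewrite /eigenvalue /eigenspace kermx_eq0 row_free_unit; apply/negP => Bu.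
  set B := M^T *m M - mu%:M in Bu.
  have [K K0 SK] := sqn_mulmx_bounded (invmx B).
  (* Coercivity: [sqn w <= K * sqn (B *m w)], and [sqn_gradient_le] bounds the right side by
     [K * (mu + 1)] times the form. A constant below the infimum would thus be admissible. *)
  suff /(ge_inf lbS) : S (mu - ((mu + 1) * K)^-1).
    apply/negP; rewrite -ltNge -/mu ltrBlDr ltrDl invr_gt0.
    by rewrite mulr_gt0// ltr_wpDl.
  move=> w; have := SK (B *m w); rewrite mulKmx// => wB.
  have := sqn_gradient_le M mu w Smu mu0.
  have -> : sqn (mu *: w - M^T *m M *m w) = sqn (B *m w).
    rewrite mulmxBl mul_scalar_mx -opprB.
    by apply: eq_bigr => i _; rewrite mxE sqrrN.
  move=> psd; rewrite mulrBl lerBrDr -lerBrDl ler_pdivrMl ?mulr_gt0 ?ltr_wpDl//.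
  by apply: le_trans wB _; rewrite [leRHS]mulrAC [leRHS]mulrC ler_wpM2l ?(ltW K0).
(* This bounds the singular values above, so that [sup] dominates [Num.sqrt mu]. Eigenvectors are
   rows here, hence the transposes. *)
have sv_le a : eigenvalue (M^T *m M) a -> a <= mu.
  move=> /eigenvalueP[v vM v0].
  have aE : sqn (M *m v^T) = a * sqn v^T.
    have vMT : M^T *m M *m v^T = (a *: v)^T by rewrite -vM !trmx_mul trmxK.
    rewrite !sqnE dotp_mulmx vMT /dotp mulr_sumr.
    by apply: eq_bigr => i _; rewrite !mxE mulrA.
  have : sqn (M *m v^T) <= mu * sqn v^T by exact: Smu.
  rewrite aE ler_pM2r// lt_def sqn_ge0 andbT.
  by apply: contraNneq v0 => /sqn_eq0 v0; rewrite -[v]trmxK v0 trmx0.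
have mu_sigma : Num.sqrt mu <= sigma_max M.
  apply: ub_le_sup; last by exists mu.
  by exists (Num.sqrt mu) => _ [a /sv_le ? <-]; rewrite ler_wsqrtr.
apply: le_trans (Smu u) _; rewrite ler_wpM2r ?sqn_ge0//.
by rewrite -[leLHS]sqr_sqrtr// lerXn2r ?nnegrE ?sqrtr_ge0//
  (le_trans _ mu_sigma) ?sqrtr_ge0.
Qed.

End SquaredEuclideanNorm.

(** * Projection onto the feasible segments *)

Lemma metric_proj_segment {R : realType} (a b y : R) : a <= b ->
  metric_proj `[a, b] y = Num.max a (Num.min y b).
Proof.
move=> ab; apply: xget_unique.
  split=> [|w]; rewrite /= !in_itv/=.
    by rewrite le_max ge_max lexx ab ge_min lexx orbT.
  move=> /andP[aw wb]; have [yb|yb] := leP y b.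
    have [ya|ya] := leP a y; first by rewrite subrr normr0.
    do 2!case: ger0P => ?; lra.
  rewrite max_r//; do 2!case: ger0P => ?; lra.
move=> z [/=]; rewrite in_itv/= => /andP[az zb] zmin.
have ayb : a <= Num.max a (Num.min y b) <= b.
  by rewrite le_max ge_max lexx ab ge_min lexx orbT.
(* Uniqueness: the minimality of [z] is tested against the clamped value. *)
have := zmin _ ayb; have [yb|yb] := leP y b.
  have [ya|ya] := leP a y.
    by rewrite subrr normr0 normr_le0 subr_eq0 => /eqP.
  do 2!case: ger0P => ?; lra.
rewrite max_r//; do 2!case: ger0P => ?; lra.
Qed.

(** Clamping is monotone, and neither the [min] nor the [max] in it increases the gap between
    ordered points. *)
Lemma metric_proj_segment_nonexpansive {R : realType} (a b y z : R) : a <= b ->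
  `|metric_proj `[a, b] y - metric_proj `[a, b] z| <= `|y - z|.
Proof.
wlog yz : y z / y <= z.
  move=> H; have [/H//|/ltW /H/[apply]] := leP y z.
  by rewrite distrC [leRHS]distrC.
move=> ab; rewrite !metric_proj_segment//.
have min_mono u w : u <= w -> Num.min u b <= Num.min w b by move=> uw; rewrite le_min2.
rewrite !ler0_norm ?subr_le0//.
  have min_le : Num.min z b - Num.min y b <= z - y.
    by have [?|?] := leP z b; have [?|?] := leP y b; lra.
  have max_le u w : u <= w -> Num.max a w - Num.max a u <= w - u.
    by move=> ?; have [?|?] := leP a w; have [?|?] := leP a u; lra.
  have := max_le _ _ (min_mono _ _ yz); lra.
by rewrite le_max2// min_mono.
Qed.

Lemma q_max_ge0 {R : realType} (p s rho : R) :
  0 <= p -> 0 <= rho <= pi / 2 -> 0 <= q_max p s rho.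
Proof.
move=> p0 /andP[rho0 rhopi]; rewrite /q_max.
case: eqP => [_|/eqP rhoN]; first exact: sqrtr_ge0.
rewrite le_min sqrtr_ge0 andbT mulr_ge0// /tan divr_ge0//.
  by apply: sin_ge0_pi; rewrite rho0/=; have := pi_ge0 R; lra.
by apply: cos_ge0_pihalf; rewrite rhopi andbT; have := pi_ge0 R; lra.
Qed.

(** Puts both kinds of bus in one form: a singleton is a degenerate segment. *)
Lemma feasible_segment {R : realType} (inverter : bool) (p s rho qc : R) :
  (inverter -> 0 <= p <= s) -> (inverter -> 0 <= rho <= pi / 2) ->
  exists a b, a <= b /\ feasible inverter p s rho qc = `[a, b].
Proof.
case: inverter => pP rhoP.
  have [/andP[p0 _] rho0] := (pP isT, rhoP isT).
  exists (- q_max p s rho), (q_max p s rho); split => //.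
  by have := q_max_ge0 _ s _ p0 rho0; lra.
by exists qc, qc; split => //; rewrite set_itv1.
Qed.

(** * Lipschitz bound for a control function with deadband *)

Section DeadbandLipschitz.
Context {R : realType} (f : R -> R) (d alpha : R).
Hypothesis d_ge0 : 0 <= d.
Hypothesis f_cont : continuous f.
Hypothesis f_deadband : forall y, deadband d y -> f y = 0.
Hypothesis f_diff : forall y, off_deadband d y -> derivable f y 1.
Hypothesis f_slope : forall y, off_deadband d y -> `|f^`() y| <= alpha.

(** Mean value theorem. Only the open interval must avoid the deadband, so an endpoint may be an
    edge of it, where mere continuity is known. *)
Lemma lipschitz_off_deadband y z : y <= z ->
  (forall c, c \in `]y, z[%R -> off_deadband d c) ->
  `|f y - f z| <= alpha * (z - y).
Proof.
rewrite le_eqVlt => /predU1P[->|yz] off; first by rewrite !subrr normr0 mulr0.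
have f_der c : c \in `]y, z[%R -> is_derive c 1 f (f^`() c).
  by move=> /off/f_diff fc; rewrite derive1E; exact: DeriveDef.
have [|c /off offc fE] := MVT yz f_der.
  exact: continuous_subspaceT.
rewrite distrC fE normrM [`|z - y|]gtr0_norm ?subr_gt0//.
by rewrite ler_wpM2r ?subr_ge0 ?(ltW yz)// f_slope.
Qed.

(** The segment is cut at the edges [- m] and [m] of the deadband; bounds with the same constant add
    up across a cut. *)
Lemma deadband_lipschitz y z : 0 <= alpha -> `|f y - f z| <= alpha * `|y - z|.
Proof.
move=> alpha0; wlog yz : y z / y <= z.
  move=> H; have [/H//|/ltW /H] := leP y z.
  by rewrite distrC [in leRHS]distrC.
rewrite [`|y - z|]ler0_norm ?subr_le0// opprB.
pose m := d / 2; have m0 : 0 <= m by rewrite divr_ge0.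
have left u w : u <= w -> w <= - m -> `|f u - f w| <= alpha * (w - u).
  move=> uw wm; apply: lipschitz_off_deadband => // c.
  rewrite in_itv/= => /andP[_ cw]; left; rewrite /= in_itv/=.
  exact: lt_le_trans wm.
have right u w : m <= u -> u <= w -> `|f u - f w| <= alpha * (w - u).
  move=> mu uw; apply: lipschitz_off_deadband => // c.
  rewrite in_itv/= => /andP[uc _]; right; rewrite /= in_itv/= andbT.
  exact: le_lt_trans mu _.
have mid u w : - m <= u -> u <= w -> w <= m -> `|f u - f w| <= alpha * (w - u).
  move=> mu uw wm; rewrite !f_deadband ?subrr ?normr0 ?mulr_ge0 ?subr_ge0//;
    by rewrite /deadband/= in_itv/= -/m; apply/andP; split; lra.
have glue u w v : `|f u - f w| <= alpha * (w - u) ->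
    `|f w - f v| <= alpha * (v - w) -> `|f u - f v| <= alpha * (v - u).
  move=> uw wv; apply: le_trans (ler_distD (f w) _ _) _.
  by apply: le_trans (lerD uw wv) _; rewrite -mulrDr addrC subrKA.
have from_mid u : - m <= u -> u <= z -> `|f u - f z| <= alpha * (z - u).
  move=> mu uz; have [zm|/ltW mz] := leP z m; first exact: mid.
  have [um|/ltW um] := leP u m; last exact: right.
  by apply: (glue _ m); [exact: mid|exact: right].
have [my|/ltW ym] := leP (- m) y; first exact: from_mid.
have [zm|/ltW mz] := leP z (- m); first exact: left.
by apply: (glue _ (- m)); [exact: left|exact: from_mid].
Qed.

End DeadbandLipschitz.

(** * Fixed points of Euclidean contractions *)

HB.instance Definition _ (R : realType) (m n : nat) := Complete.on 'M[R]_(m, n).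

Section EuclideanContraction.
Context {R : realType} {n : nat} (F : 'cV[R]_n -> 'cV[R]_n) (mu : R).
Hypothesis mu01 : 0 <= mu < 1.
Hypothesis F_contr : forall q r, sqn (F q - F r) <= mu * sqn (q - r).

Lemma sqn_iter_contraction k q r :
  sqn (iter k F q - iter k F r) <= mu ^+ k * sqn (q - r).
Proof.
have /andP[mu0 _] := mu01.
elim: k => [|k IHk]; first by rewrite expr0 mul1r.
by apply: le_trans (F_contr _ _) _; rewrite exprS -mulrA ler_wpM2l.
Qed.

Lemma euclidean_contraction_fixed_point : exists q, q = F q.
Proof.
have /andP[mu0 mu1] := mu01.
(* Banach's theorem is applied to an iterate, since F itself need not be a
   contraction for the max norm. *)
have [k muk] : exists k, n%:R * mu ^+ k < 4^-1.
  have mu_lt1 : `|mu| < 1 by rewrite ger0_norm.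
  have /cvgrPdist_lt /(_ 4^-1) := cvg_geometric n%:R mu_lt1.
  case=> [|N _ /(_ N (leqnn N))]; first by rewrite invr_gt0.
  rewrite /= sub0r normrN => muN; exists N; exact: le_lt_trans (ler_norm _) muN.
(* Passing to the max norm costs a factor [n] on squares; [n%:R * mu ^+ k < 4^-1] then gives the
   ratio 1/2 after square roots. *)
have G_contr q r : `|iter k F q - iter k F r| <= 2^-1 * `|q - r|.
  rewrite -(@ler_pXn2r _ 2) ?nnegrE ?mulr_ge0//.
  apply: le_trans (ler_norm_sqn _) _; apply: le_trans (sqn_iter_contraction _ _ _) _.
  apply: (@le_trans _ _ (mu ^+ k * (n%:R * `|q - r| ^+ 2))).
    by rewrite ler_wpM2l ?exprn_ge0// ler_sqn_norm.
  rewrite mulrA [mu ^+ k * _]mulrC exprMn ler_wpM2r ?sqr_ge0//.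
  by apply: le_trans (ltW muk) _; lra.
pose G : {fun [set: 'cV[R]_n] >-> [set: 'cV[R]_n]} := [fun of totalfun (iter k F)].
have [||q _ qG] := @banach_fixed_point _ _ setT G _ closedT.
- exists (2^-1)%:nng; split=> /=; first by lra.
  by move=> [q r] _ /=; exact: G_contr.
- by exists 0.
(* The iterate commutes with [F], so it fixes [F q] as well as [q]; their distance is at most half
   of itself. *)
exists q; apply/eqP; rewrite -subr_eq0 -normr_eq0 eq_le normr_ge0 andbT.
have := G_contr q (F q); rewrite -iterSr iterS -[iter k F q]/(G q) -qG.
by have := normr_ge0 (q - F q); lra.
Qed.

End EuclideanContraction.

(** * Equilibrium, convergence and rate of the dynamics *)

Lemma sigma_max_ge0 {R : realType} {m n} (M : 'M[R]_(m, n)) : 0 <= sigma_max M.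
Proof.
have [M_sup|/sup_out] := pselect (has_sup (singular_values M)); last first.
  (* Without a supremum, as for [n = 0], [sup] takes its default value 0. *)
  by move=> sup0; rewrite /sigma_max sup0.
have [[_ [a aM _]] _] := M_sup.
apply: le_trans (sqrtr_ge0 a) _.
by apply: sup_upper_bound => //; exists a.
Qed.

Lemma geometric_cvg {R : realType} {V : normedModType R} (u : nat -> V) l K z :
  0 <= z < 1 -> (forall t, `|u t - l| <= K * z ^+ t) -> u t @[t --> \oo] --> l.
Proof.
move=> /andP[z0 z1] uK; apply/subr_cvg0/norm_cvg0P.
apply: (@squeeze_cvgr _ _ _ _ (cst 0) (geometric K z)).
- by apply: nearW => t; rewrite normr_ge0 uK.
- exact: cvg_cst.
- by apply: cvg_geometric; rewrite ger0_norm.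
Qed.

Theorem theorem3 (R : realType) (n : nat)
    (L : {set {set 'I_n.+1}}) (x : {set 'I_n.+1} -> R)
    (L_tree : is_tree L)
    (x_gt0 : forall l, l \in L -> 0 < x l)
    (vt : 'cV[R]_n)
    (inverter : 'I_n -> bool) (p s rho qc : 'I_n -> R)
    (p_bounds : forall i, inverter i -> 0 <= p i <= s i)
    (rho_bounds : forall i, inverter i -> 0 <= rho i <= pi / 2)
    (f : 'I_n -> R -> R) (delta alpha : 'I_n -> R)
    (delta_ge0 : forall i, 0 <= delta i)
    (f_cont : forall i, continuous (f i))
    (f_deadband : forall i y, deadband (delta i) y -> f i y = 0)
    (f_nonincr : forall i y z, y <= z -> f i z <= f i y)
    (f_decr : forall i y z, off_deadband (delta i) y ->
       off_deadband (delta i) z -> y < z -> f i z < f i y)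
    (f_diff : forall i y, off_deadband (delta i) y -> derivable (f i) y 1)
    (alpha_gt0 : forall i, 0 < alpha i)
    (f_slope : forall i y,
       (off_deadband (delta i) `|` `]- (delta i / 2), delta i / 2[) y ->
       `|(f i)^`() y| <= alpha i)
    (sigma_lt1 :
       sigma_max (diag_mx (\row_i alpha i) *m reactance_mx L x) < 1) :
  let X := reactance_mx L x in
  let Om := fun i => feasible (inverter i) (p i) (s i) (rho i) (qc i) in
  exists vs qs : 'cV[R]_n,
    [/\ equilibrium X vt Om f vs qs,
        forall v' q' : 'cV[R]_n,
          equilibrium X vt Om f v' q' -> v' = vs /\ q' = qs,
        forall v q : nat -> 'cV[R]_n, trajectory X vt Om f v q ->
          v t @[t --> \oo] --> vs /\ q t @[t --> \oo] --> qs
      & exists C lambda : R, [/\ 0 < C, 0 < lambda, lambda < 1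
          & forall v q : nat -> 'cV[R]_n, trajectory X vt Om f v q ->
            forall t : nat, `|(v t, q t) - (vs, qs)| <=
              C * lambda ^+ t * `|(v 0%N, q 0%N) - (vs, qs)|]].
Proof.
move=> X Om.
have Om_segment i : exists a b, a <= b /\ Om i = `[a, b].
  by apply: feasible_segment; [exact: p_bounds|exact: rho_bounds].
pose M := diag_mx (\row_i alpha i) *m X.
pose F q := control Om f (X *m q + vt).
(* The maximum with 1/4 makes the rate strictly positive even if [sigma_max M] is 0, as for
   [n = 0]. *)
pose mu := Num.max (sigma_max M ^+ 2) 4^-1.
have mu_gt0 : 0 < mu by rewrite lt_max invr_gt0 ltr0n orbT.
have mu_lt1 : mu < 1.
  rewrite gt_max expr_lt1 ?sigma_max_ge0//; apply/andP; split => //.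
  by lra.
have FE q i : F q i 0 =
    metric_proj (Om i) (f i ((X *m q + vt - v_nom R n) i 0)) by rewrite mxE.
have f_lip i y z : `|f i y - f i z| <= alpha i * `|y - z|.
  apply: (deadband_lipschitz _ (delta i)) => //; last exact: ltW.
  - exact: f_deadband.
  - exact: f_diff.
  - by move=> c c_off; apply: f_slope; left.
have F_contr q r : sqn (F q - F r) <= mu * sqn (q - r).
  apply: le_trans (_ : sqn (M *m (q - r)) <= _); last first.
    apply: le_trans (sqn_mulmx_le_sigma_max _ _) _.
    by rewrite ler_wpM2r ?sqn_ge0// le_max lexx.
  rewrite -mulmxA; apply: sqn_diag_mx_le => i.
  have [a [b [ab OmE]]] := Om_segment i.
  rewrite [in leLHS]mxE [in X in _ + X]mxE !FE OmE.
  apply: le_trans (metric_proj_segment_nonexpansive _ _ _ _ ab) _.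
  apply: le_trans (f_lip _ _ _) _.
  rewrite ler_pM2l// mulmxBr !mxE le_eqVlt; apply/predU1P; left.
  by congr `|_|; ring.
have mu01 : 0 <= mu < 1 by rewrite ltW.
have [qs qsE] := euclidean_contraction_fixed_point _ _ mu01 F_contr.
have [K K0 XK] := sqn_mulmx_bounded X.
(* Square roots, as [mu] governs squared norms. [K + 1] serves both the voltages, through [X], and
   the injections; [n.+1] comes from the norm comparison and stays positive for [n = 0]. *)
pose C := Num.sqrt ((K + 1) * n.+1%:R); pose lambda := Num.sqrt mu.
have K1_gt0 : 0 < K + 1 by rewrite addr_gt0.
have C2 : C ^+ 2 = (K + 1) * n.+1%:R by rewrite sqr_sqrtr// mulr_ge0// ltW.
have l2 : lambda ^+ 2 = mu by rewrite sqr_sqrtr// ltW.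
have rate v q : trajectory X vt Om f v q -> forall t,
    `|(v t, q t) - (X *m qs + vt, qs)| <=
      C * lambda ^+ t * `|(v 0%N, q 0%N) - (X *m qs + vt, qs)|.
  move=> [_ vE qE] t.
  have q_iter s' : q s' = iter s' F (q 0%N).
    by elim: s' => //= s' <-; rewrite qE vE.
  have qs_iter s' : qs = iter s' F qs by elim: s' => //= s' <-.
  set D := (X in _ <= _ * X).
  have qD : `|q 0%N - qs| <= D by rewrite /D prod_normE/= le_max lexx orbT.
  have sq_rate : sqn (q t - qs) <= n.+1%:R * mu ^+ t * D ^+ 2.
    rewrite q_iter [in leLHS](qs_iter t).
    apply: le_trans (sqn_iter_contraction _ _ mu01 F_contr _ _ _) _.
    rewrite [n.+1%:R * _]mulrC -mulrA ler_wpM2l ?exprn_ge0 ?(ltW mu_gt0)//.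
    apply: le_trans (ler_sqn_norm _) _.
    by rewrite ler_pM ?sqr_ge0// ?ler_nat ?leqnSn ?lerXn2r ?nnegrE ?normr_ge0.
  have rate_of (V : normedModType R) (w : V) :
      `|w| ^+ 2 <= (K + 1) * sqn (q t - qs) -> `|w| <= C * lambda ^+ t * D.
    move=> w_le; rewrite -(@ler_pXn2r _ 2) ?nnegrE
      ?mulr_ge0 ?exprn_ge0 ?sqrtr_ge0 ?normr_ge0//.
    rewrite !exprMn C2 exprAC l2; apply: le_trans w_le _.
    by rewrite -!mulrA ler_pM2l// mulrA.
  (* The norm of a pair is the maximum of the two norms, and the voltage error is
     [X *m (q t - qs)]. *)
  rewrite prod_normE/= ge_max; apply/andP; split; apply: rate_of.
    rewrite vE opprD addrACA subrr addr0 -mulmxBr.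
    apply: le_trans (ler_norm_sqn _) _; apply: le_trans (XK _) _.
    by rewrite ler_wpM2r ?sqn_ge0//; lra.
  apply: le_trans (ler_norm_sqn _) _.
  by rewrite ler_peMl ?sqn_ge0//; lra.
have lambda_gt0 : 0 < lambda by rewrite sqrtr_gt0.
have lambda_lt1 : lambda < 1 by rewrite -sqrtr1 ltr_sqrt.
exists (X *m qs + vt), qs; split.
- by split.
- move=> v' q' [v'E q'E].
  suff q'qs : q' = qs by rewrite v'E q'qs.
  apply/eqP; rewrite -subr_eq0; apply/eqP/sqn_eq0/eqP.
  (* Both points are fixed, so their squared distance is at most [mu < 1] times itself. *)
  have := F_contr q' qs; rewrite -qsE /F -v'E -q'E.
  by have := sqn_ge0 (q' - qs); nra.
- move=> v q /rate vq_rate.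
  pose D := `|(v 0%N, q 0%N) - (X *m qs + vt, qs)|.
  have bnd t : Num.max `|v t - (X *m qs + vt)| `|q t - qs| <= C * D * lambda ^+ t.
    by have := vq_rate t; rewrite prod_normE/= mulrAC.
  have l01 : 0 <= lambda < 1 by rewrite ltW.
  by split; apply: (geometric_cvg _ _ _ _ l01) => t; apply: le_trans (bnd t);
    rewrite le_max lexx ?orbT.
- exists C, lambda; split => //.
  by rewrite sqrtr_gt0 mulr_gt0.
Qed.
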